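(* Let $A\in\mathbb{R}^{n_x\times n_x}$, $C\in\mathbb{R}^{n_x\times n_c}$, $D\in\mathbb{R}^{n_c\times n_x}$, $F\in\mathbb{R}^{n_c\times n_c}$, and consider the DLCS $$x_{k+1}=Ax_k+C\lambda_{k+1},\qquad 0\le \lambda_{k+1}\perp Dx_k+F\lambda_{k+1}\ge 0 .$$ Assume that $F$ is a Q-matrix and an R$_0$-matrix. For $P_{xx}\in\mathbb{S}^{n_x}$ let $$\psi(x,\lambda)=\begin{pmatrix}x\\ \lambda\end{pmatrix}^T M(P_{xx})\begin{pmatrix}x\\ \lambda\end{pmatrix},\qquad M(P_{xx})=\begin{pmatrix}A^TP_{xx}A-P_{xx} & A^TP_{xx}C\\ C^TP_{xx}A & C^TP_{xx}C\end{pmatrix}.$$ Then the equilibrium point $x^e=0$ is (i) stable if there exists a positive definite $P_{xx}\in\mathbb{S}^{n_x}$ with $\psi(x,\lambda)\le 0$ for all $(x,\lambda)\in \mathrm{Gr}\,\mathrm{SOL}(Dx,F)$; and (ii) exponentially stable if there exists a positive definite $P_{xx}\in\mathbb{S}^{n_x}$ with $\psi(x,\lambda)<0$ for all nonzero $(x,\lambda)\in \mathrm{Gr}\,\mathrm{SOL}(Dx,F)$.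
   Context: $\mathbb{S}^n$ denotes the real symmetric $n\times n$ matrices. For $q\in\mathbb{R}^{n_c}$ and $M\in\mathbb{R}^{n_c\times n_c}$, $\mathrm{LCP}(q,M)$ is the problem of finding $\lambda\in\mathbb{R}^{n_c}$ with $0\le\lambda\perp M\lambda+q\ge 0$ (i.e. $\lambda\ge0$, $M\lambda+q\ge0$ componentwise, $\lambda^T(M\lambda+q)=0$), and $\mathrm{SOL}(q,M)$ is its solution set. $M$ is a Q-matrix if $\mathrm{SOL}(q,M)\neq\emptyset$ for all $q$; $M$ is an R$_0$-matrix if $\mathrm{SOL}(0,M)=\{0\}$. $\mathrm{Gr}\,\mathrm{SOL}(Dx,F)=\{(x,\lambda): \lambda\in\mathrm{SOL}(Dx,F)\}\subseteq\mathbb{R}^{n_x+n_c}$. A trajectory of the DLCS from the initial state $\hat x$ is a sequence $(x_k)_{k\ge0}$ with $x_0=\hat x$ and $x_{k+1}=Ax_k+C\lambda_{k+1}$ for some $\lambda_{k+1}\in\mathrm{SOL}(Dx_k,F)$, for all $k\ge0$; trajectories need not be unique. The equilibrium $x^e=0$ is - stable (in the sense of Lyapunov) if for each $\epsilon>0$ there is $\delta_\epsilon>0$ such that $\|\hat x-x^e\|<\delta_\epsilon$ implies $\|x_k-x^e\|<\epsilon$ for all $k\in\mathbb{Z}_+$ and all trajectories from $\hat x$; - exponentially stable if there are scalars $\delta>0$, $c>0$, $0\le\mu<1$ such that $\|\hat x-x^e\|<\delta$ implies $\|x_k-x^e\|\le c\mu^k\|\hat x-x^e\|$ for all $k\in\mathbb{Z}_+$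 and all trajectories from $\hat x$. *)

(* Defs.v *)
From mathcomp Require Import all_boot all_order all_algebra.
From mathcomp Require Import boolp classical_sets reals.

Set Implicit Arguments.
Unset Strict Implicit.
Unset Printing Implicit Defensive.

Import Order.TTheory GRing.Theory Num.Theory.

Local Open Scope ring_scope.
Local Open Scope classical_set_scope.

(* The library's norm on matrices over a real type is the sup norm; this is
   the Euclidean one. *)
Definition enorm (R : realType) (n : nat) (x : 'cV[R]_n) : R :=
  Num.sqrt (\sum_(i < n) x i 0 ^+ 2).

Definition quadform (R : realType) (n : nat) (M : 'M[R]_n) (z : 'cV[R]_n) : R :=
  (z^T *m M *m z) 0 0.

(* Positivity only: symmetry of the matrix is a separate hypothesis. *)
Definition posdef (R : realType) (n : nat) (P : 'M[R]_n) : Prop :=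
  forall x : 'cV[R]_n, x != 0 -> 0 < quadform P x.

Definition nonneg (R : realType) (n : nat) (v : 'cV[R]_n) : Prop :=
  forall i : 'I_n, 0 <= v i 0.

Definition SOL (R : realType) (n : nat) (q : 'cV[R]_n) (M : 'M[R]_n) :
    set 'cV[R]_n :=
  [set lam | [/\ nonneg lam, nonneg (M *m lam + q) &
                 (lam^T *m (M *m lam + q)) 0 0 = 0]].

Definition Qmatrix (R : realType) (n : nat) (M : 'M[R]_n) : Prop :=
  forall q : 'cV[R]_n, SOL q M !=set0.

Definition R0matrix (R : realType) (n : nat) (M : 'M[R]_n) : Prop :=
  SOL 0 M = [set 0].

Definition GrSOL (R : realType) (nx nc : nat)
    (D : 'M[R]_(nc, nx)) (F : 'M[R]_nc) : set 'cV[R]_(nx + nc) :=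
  [set z | SOL (D *m usubmx z) F (dsubmx z)].

Definition trajectory (R : realType) (nx nc : nat)
    (A : 'M[R]_nx) (C : 'M[R]_(nx, nc)) (D : 'M[R]_(nc, nx)) (F : 'M[R]_nc)
    (xhat : 'cV[R]_nx) (x : nat -> 'cV[R]_nx) : Prop :=
  x 0%N = xhat /\
  forall k : nat, exists2 lam : 'cV[R]_nc,
    SOL (D *m x k) F lam & x k.+1 = A *m x k + C *m lam.

Definition stable (R : realType) (nx nc : nat)
    (A : 'M[R]_nx) (C : 'M[R]_(nx, nc)) (D : 'M[R]_(nc, nx)) (F : 'M[R]_nc)
    (xe : 'cV[R]_nx) : Prop :=
  forall eps : R, 0 < eps -> exists2 delta : R, 0 < delta &
    forall xhat : 'cV[R]_nx, enorm (xhat - xe) < delta ->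
    forall x : nat -> 'cV[R]_nx, trajectory A C D F xhat x ->
    forall k : nat, enorm (x k - xe) < eps.

Definition exponentially_stable (R : realType) (nx nc : nat)
    (A : 'M[R]_nx) (C : 'M[R]_(nx, nc)) (D : 'M[R]_(nc, nx)) (F : 'M[R]_nc)
    (xe : 'cV[R]_nx) : Prop :=
  exists delta c mu : R, [/\ 0 < delta, 0 < c, 0 <= mu < 1 &
    forall xhat : 'cV[R]_nx, enorm (xhat - xe) < delta ->
    forall x : nat -> 'cV[R]_nx, trajectory A C D F xhat x ->
    forall k : nat, enorm (x k - xe) <= c * mu ^+ k * enorm (xhat - xe)].

Definition Mlyap (R : realType) (nx nc : nat)
    (A : 'M[R]_nx) (C : 'M[R]_(nx, nc)) (Pxx : 'M[R]_nx) : 'M[R]_(nx + nc) :=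
  block_mx (A^T *m Pxx *m A - Pxx) (A^T *m Pxx *m C)
           (C^T *m Pxx *m A)       (C^T *m Pxx *m C).

Definition psi (R : realType) (nx nc : nat)
    (A : 'M[R]_nx) (C : 'M[R]_(nx, nc)) (Pxx : 'M[R]_nx)
    (x : 'cV[R]_nx) (lam : 'cV[R]_nc) : R :=
  quadform (Mlyap A C Pxx) (col_mx x lam).

(* Main.v *)
Require Import Defs.
From mathcomp Require Import all_boot all_order all_algebra.
From mathcomp Require Import ring lra.
From mathcomp Require Import boolp classical_sets reals.
From mathcomp Require Import topology normedtype realfun derive.

Set Implicit Arguments.
Unset Strict Implicit.
Unset Printing Implicit Defensive.

Import Order.TTheory GRing.Theory Num.Theory.
Import numFieldNormedType.Exports.

Local Open Scope ring_scope.

(** The quadratic form [V x = x^T Pxx x] satisfies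
    [V (x_{k+1}) - V (x_k) = psi (x_k, lam_{k+1})], so it does not increase along
    trajectories in case (i).  In case (ii), the graph of [x |-> SOL (D x, F)] is
    a closed cone, so by compactness of its intersection with the unit sphere
    [psi z <= - r |z|^2] on it for some [r > 0]; hence [V] decays geometrically.
    Both conclusions follow from [a |x|^2 <= V x <= b |x|^2]. *)

(** * Euclidean norm *)

Lemma enorm_ge0 (R : realType) n (z : 'cV[R]_n) : 0 <= enorm z.
Proof. exact: sqrtr_ge0. Qed.

Lemma sqr_enorm (R : realType) n (z : 'cV[R]_n) :
  enorm z ^+ 2 = \sum_(i < n) z i 0 ^+ 2.
Proof. by rewrite sqr_sqrtr // sumr_ge0 // => i _; exact: sqr_ge0. Qed.

Lemma sqr_coord_le (R : realType) n (z : 'cV[R]_n) i :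
  z i 0 ^+ 2 <= enorm z ^+ 2.
Proof.
rewrite sqr_enorm (bigD1 i) //= lerDl sumr_ge0 // => j _.
exact: sqr_ge0.
Qed.

Lemma normr_coord_le (R : realType) n (z : 'cV[R]_n) i : `|z i 0| <= enorm z.
Proof. by rewrite -ler_sqr ?nnegrE ?enorm_ge0 // real_normK ?num_real ?sqr_coord_le. Qed.

Lemma enorm_gt0 (R : realType) n (z : 'cV[R]_n) : z != 0 -> 0 < enorm z.
Proof.
move=> z0; rewrite lt_def enorm_ge0 andbT; apply: contraNneq z0 => ez0.
apply/eqP/matrixP => i j; rewrite ord1 mxE; apply/eqP.
by rewrite -normr_le0 -ez0 normr_coord_le.
Qed.

Lemma enormZ (R : realType) n (a : R) (z : 'cV[R]_n) :
  enorm (a *: z) = `|a| * enorm z.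
Proof.
rewrite -sqrtr_sqr -sqrtrM ?sqr_ge0 // mulr_sumr.
by congr Num.sqrt; apply: eq_bigr => i _; rewrite mxE exprMn.
Qed.

Lemma enorm0 (R : realType) n : enorm (0 : 'cV[R]_n) = 0.
Proof. by rewrite -(scale0r 0) enormZ normr0 mul0r. Qed.

Lemma sqr_enorm_col_mx (R : realType) m n (x : 'cV[R]_m) (y : 'cV[R]_n) :
  enorm (col_mx x y) ^+ 2 = enorm x ^+ 2 + enorm y ^+ 2.
Proof.
rewrite !sqr_enorm big_split_ord /=.
by congr (_ + _); apply: eq_bigr => i _; rewrite ?col_mxEu ?col_mxEd.
Qed.

(** * Quadratic forms: algebra and an upper bound *)

Lemma quadformE (R : realType) n (Q : 'M[R]_n) z :
  quadform Q z = \sum_(j < n) \sum_(i < n) z i 0 * Q i j * z j 0.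
Proof.
rewrite /quadform mxE; apply: eq_bigr => j _; rewrite mxE mulr_suml.
by apply: eq_bigr => i _; rewrite mxE.
Qed.

Lemma quadformZ (R : realType) n (Q : 'M[R]_n) a z :
  quadform Q (a *: z) = a ^+ 2 * quadform Q z.
Proof. by rewrite /quadform [(a *: z)^T]linearZ /= -!scalemxAl -scalemxAr scalerA mxE -expr2. Qed.

Lemma quadformN (R : realType) n (Q : 'M[R]_n) z :
  quadform (- Q) z = - quadform Q z.
Proof. by rewrite /quadform mulmxN mulNmx mxE. Qed.

Lemma quadform0 (R : realType) n (Q : 'M[R]_n) : quadform Q 0 = 0.
Proof. by rewrite /quadform mulmx0 mxE. Qed.

Lemma quadform_ub (R : realType) n (Q : 'M[R]_n) :
  exists2 b : R, 0 < b & forall z, quadform Q z <= b * enorm z ^+ 2.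
Proof.
pose s := \sum_(j < n) \sum_(i < n) `|Q i j|.
have s0 : 0 <= s by do 2![apply: sumr_ge0 => ? _].
(* The entry sum [s] already bounds the form; adding 1 keeps the constant positive when [Q] is
   zero. *)
exists (s + 1) => [|z]; first by rewrite ltr_wpDl.
apply: (@le_trans _ _ (s * enorm z ^+ 2)); last first.
  by rewrite ler_wpM2r ?sqr_ge0 // lerDl.
rewrite quadformE /s mulr_suml; apply: ler_sum => j _.
rewrite mulr_suml; apply: ler_sum => i _; apply: le_trans (ler_norm _) _.
rewrite !normrM mulrAC mulrC ler_wpM2l // expr2.
by rewrite ler_pM ?normr_coord_le.
Qed.

(** * Continuity, and coercivity on closed cones *)

Lemma trmx_continuous (R : realType) m n :
  continuous (trmx : 'M[R]_(m, n) -> 'M[R]_(n, m)).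
Proof.
move=> x s /= /nbhs_ballP[e e0 es]; apply/nbhs_ballP; exists e => //= y [_ xy].
by apply: es; split=> // i j; rewrite !mxE; exact: xy.
Qed.

Lemma sum_continuous (R : realType) (T : topologicalType) n
    (f : 'I_n -> T -> R) :
  (forall i, continuous (f i)) -> continuous (fun x => \sum_(i < n) f i x).
Proof. by move=> fc; apply: continuous_big => //; exact: add_continuous. Qed.

Lemma mul_continuous (R : realType) (T : topologicalType) (f g : T -> R) :
  continuous f -> continuous g -> continuous (fun x => f x * g x).
Proof. by move=> fc gc x; apply: cvgM; [exact: fc|exact: gc]. Qed.

Lemma quadform_continuous (R : realType) n (Q : 'M[R]_n) :
  continuous (quadform Q).
Proof.
rewrite (_ : quadform Q = fun z => \sum_(j < n) \sum_(i < n) z i 0 * Q i j * z j 0).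
  apply: sum_continuous => j; apply: sum_continuous => i.
  apply: mul_continuous; last exact: coord_continuous.
  by apply: mul_continuous; [exact: coord_continuous|exact: cst_continuous].
by apply/funext => z; exact: quadformE.
Qed.

Lemma mulmx_coord_continuous (R : realType) m n (M : 'M[R]_(m, n)) i :
  continuous (fun z : 'cV[R]_n => (M *m z) i 0).
Proof.
rewrite (_ : (fun _ => _) = fun z : 'cV[R]_n => \sum_(j < n) M i j * z j 0).
  apply: sum_continuous => j.
  by apply: mul_continuous; [exact: cst_continuous|exact: coord_continuous].
by apply/funext => z; rewrite mxE.
Qed.

Lemma enorm_continuous (R : realType) n : continuous (@enorm R n).
Proof.
move=> z; apply: (continuous_comp (g := Num.sqrt)); last exact: sqrt_continuous.
by apply: sum_continuous => i; apply: mul_continuous; exact: coord_continuous.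
Qed.

(* Heine-Borel and the extreme value theorem are available for row vectors
   only, hence the transpositions. *)
Lemma quadform_coercive (R : realType) n (K : set 'cV[R]_n) (Q : 'M[R]_n) :
  closed K ->
  (forall a z, 0 < a -> K z -> K (a *: z)) ->
  (forall z, K z -> z != 0 -> 0 < quadform Q z) ->
  exists2 c : R, 0 < c & forall z, K z -> c * enorm z ^+ 2 <= quadform Q z.
Proof.
move=> Kcl Kcone Qpos.
pose S : set 'rV[R]_n := [set v | K v^T /\ enorm v^T = 1]%classic.
have Scl : closed S.
  apply: closedI.
    exact: (continuous_closedP _).1 (@trmx_continuous R 1 n) _ Kcl.
  apply: ((continuous_closedP (fun v : 'rV[R]_n => enorm v^T)).1 _ _ (@closed_eq R 1)).
  by move=> v; apply: continuous_comp; [exact: trmx_continuous|exact: enorm_continuous].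
have Sco : compact S.
  (* Coordinates are bounded by the Euclidean norm, so [S] is a closed subset of this cube. *)
  have box : compact [set v : 'rV[R]_n | forall i, v ord0 i \in `[-1, 1]%R]%classic.
    apply: (@rV_compact R n (fun=> `[(-1 : R), 1]%classic)) => _.
    exact: segment_compact.
  apply: subclosed_compact Scl box _.
  move=> v [_ v1] i /=; rewrite in_itv /= -ler_norml -v1.
  by have := normr_coord_le v^T i; rewrite mxE.
have Sunit z : K z -> z != 0 -> S ((enorm z)^-1 *: z)^T.
  move=> Kz /enorm_gt0 z0; split; rewrite trmxK.
    by apply: Kcone => //; rewrite invr_gt0.
  by rewrite enormZ ger0_norm ?invr_ge0 ?enorm_ge0 // mulVf ?gt_eqF.
(* If [S] is empty, then [K] has no nonzero point and any positive constant works. *)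
have [S0|/set0P/negP/negPn/eqP S0] := pselect (S !=set0)%classic; last first.
  exists 1 => // z Kz; have [->|z0] := eqVneq z 0.
    by rewrite quadform0 enorm0 expr0n mulr0.
  by have := Sunit _ Kz z0; rewrite S0.
have Qc : {within S, continuous (fun v : 'rV[R]_n => quadform Q (v^T)%R)}%classic.
  apply: continuous_subspaceT => v; apply: continuous_comp.
    exact: trmx_continuous.
  exact: quadform_continuous.
have [v /set_mem[Kv v1] vmin] := EVT_min_rV S0 Sco Qc.
have v0 : v^T != 0.
  apply/eqP => v0; move/eqP: v1; rewrite v0 enorm0.
  by rewrite eq_sym oner_eq0.
(* The constant is the minimum of the form on [S]; homogeneity of degree two carries the bound from
   [S] to all of [K]. *)
exists (quadform Q v^T) => [|z Kz]; first exact: Qpos.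
have [->|z0] := eqVneq z 0.
  by rewrite quadform0 enorm0 expr0n mulr0.
have := vmin _ (mem_set (Sunit _ Kz z0)).
rewrite trmxK quadformZ exprVn mulrC ler_pdivlMr //.
by rewrite exprn_gt0 ?enorm_gt0.
Qed.

Lemma posdef_coercive (R : realType) n (P : 'M[R]_n) : posdef P ->
  exists2 a : R, 0 < a & forall z, a * enorm z ^+ 2 <= quadform P z.
Proof.
move=> Ppos; have [|//|z _|a a0 Pa] := @quadform_coercive R n setT P.
- exact: closedT.
- exact: Ppos.
by exists a => // z; exact: Pa.
Qed.

(** * The graph of the LCP solution map as a closed cone *)

(** Each condition becomes a sign condition on a continuous homogeneous function of the stacked
    vector, so closedness and invariance under scaling can be checked one condition at a time.
    Complementarity is the quadratic form with zero upper blocks. *)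
Lemma GrSOL_P (R : realType) nx nc (D : 'M[R]_(nc, nx)) (F : 'M[R]_nc)
    (z : 'cV[R]_(nx + nc)) :
  GrSOL D F z <->
  [/\ forall i, 0 <= z (rshift nx i) 0,
      forall i, 0 <= (row_mx D F *m z) i 0 &
      quadform (block_mx 0 0 D F) z = 0].
Proof.
rewrite -[z]vsubmxK; set x := usubmx z; set y := dsubmx z.
rewrite /GrSOL /SOL /= col_mxKu col_mxKd mul_row_col addrC.
rewrite /quadform tr_col_mx mul_row_block !mulmx0 !add0r mul_row_col -!mulmxA.
by rewrite -mulmxDr; split=> -[yge ? ?]; split=> // i; have := yge i; rewrite col_mxEd.
Qed.

Lemma GrSOL_closed (R : realType) nx nc (D : 'M[R]_(nc, nx)) (F : 'M[R]_nc) :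
  closed (GrSOL D F).
Proof.
rewrite (_ : GrSOL D F =
    ((\bigcap_i [set z : 'cV[R]_(nx + nc) | 0 <= z (rshift nx i) 0]) `&`
     (\bigcap_i [set z : 'cV[R]_(nx + nc) | 0 <= (row_mx D F *m z) i 0]) `&`
     [set z : 'cV[R]_(nx + nc) | quadform (block_mx 0 0 D F) z = 0])%classic); last first.
  apply/seteqP; split=> z.
    by move=> /GrSOL_P[h1 h2 h3]; split=> //; split=> i _; [exact: h1|exact: h2].
  by move=> [[h1 h2] h3]; apply/GrSOL_P; split=> // i; [exact: (h1 i)|exact: (h2 i)].
apply: closedI; first apply: closedI.
- apply: closed_bigI => i _.
  exact: (continuous_closedP _).1 (@coord_continuous _ _ _ _ _) _ (@closed_ge R 0).
- apply: closed_bigI => i _.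
  exact: (continuous_closedP _).1 (@mulmx_coord_continuous _ _ _ _ _) _ (@closed_ge R 0).
- exact: (continuous_closedP _).1 (@quadform_continuous _ _ _) _ (@closed_eq R 0).
Qed.

Lemma GrSOL_cone (R : realType) nx nc (D : 'M[R]_(nc, nx)) (F : 'M[R]_nc)
    (a : R) (z : 'cV[R]_(nx + nc)) :
  0 < a -> GrSOL D F z -> GrSOL D F (a *: z).
Proof.
move=> /ltW a0 /GrSOL_P[h1 h2 h3]; apply/GrSOL_P; split=> [i|i|].
- by rewrite mxE mulr_ge0.
- by rewrite -scalemxAr mxE mulr_ge0.
- by rewrite quadformZ h3 mulr0.
Qed.

(** * Lyapunov decrease and the two stability claims *)

Lemma psiE (R : realType) nx nc (A : 'M[R]_nx) (C : 'M[R]_(nx, nc)) P x lam :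
  psi A C P x lam = quadform P (A *m x + C *m lam) - quadform P x.
Proof.
rewrite /psi /Mlyap /quadform tr_col_mx mul_row_block mul_row_col.
have -> (X Y : 'M[R]_1) : X 0 0 - Y 0 0 = (X - Y) 0 0 by rewrite !mxE.
congr (fun_of_matrix _ 0 0); rewrite [(_ + _)^T]linearD /= !trmx_mul.
rewrite !(mulmxDl, mulmxDr, mulmxN, mulNmx, mulmxA).
by rewrite -!addrA; congr (_ + _); rewrite addrC -!addrA.
Qed.

(** Chain [a |x_k|^2 <= V x_k <= q^k V x_0 <= q^k b |x_0|^2] and take square roots. Stability uses
    [q = 1], exponential stability some [q < 1]. *)
Lemma lyapunov_decay (R : realType) n (P : 'M[R]_n) (a b q : R)
    (x : nat -> 'cV[R]_n) :
  0 < a -> (forall z, a * enorm z ^+ 2 <= quadform P z) ->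
  (forall z, quadform P z <= b * enorm z ^+ 2) -> 0 < b -> 0 <= q ->
  (forall k, quadform P (x k.+1) <= q * quadform P (x k)) ->
  forall k, enorm (x k) <= Num.sqrt (b / a) * Num.sqrt q ^+ k * enorm (x 0%N).
Proof.
move=> a0 Pa Pb b0 q0 Pq k.
have Pk : quadform P (x k) <= q ^+ k * quadform P (x 0%N).
  elim: k => [|k IH]; first by rewrite mul1r.
  by apply: le_trans (Pq k) _; rewrite exprS -mulrA ler_wpM2l.
have qk : 0 <= q ^+ k by rewrite exprn_ge0.
rewrite -ler_sqr ?nnegrE ?mulr_ge0 ?exprn_ge0 ?sqrtr_ge0 ?enorm_ge0 //.
rewrite !exprMn exprAC (sqr_sqrtr q0) [Num.sqrt (b / a) ^+ 2]sqr_sqrtr; last first.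
  by rewrite divr_ge0 ?ltW.
have -> (e : R) : b / a * q ^+ k * e = q ^+ k * (b * e) / a by ring.
rewrite ler_pdivlMr // mulrC; apply: le_trans (Pa _) (le_trans Pk _).
by rewrite ler_wpM2l.
Qed.

Theorem theorem1 (R : realType) (nx nc : nat)
    (A : 'M[R]_nx) (C : 'M[R]_(nx, nc)) (D : 'M[R]_(nc, nx)) (F : 'M[R]_nc)
    (FQ : Qmatrix F) (FR0 : R0matrix F) :
  ((exists Pxx : 'M[R]_nx, [/\ Pxx^T = Pxx, posdef Pxx &
      forall (x : 'cV[R]_nx) (lam : 'cV[R]_nc),
        GrSOL D F (col_mx x lam) -> psi A C Pxx x lam <= 0]) ->
    stable A C D F 0)
  /\
  ((exists Pxx : 'M[R]_nx, [/\ Pxx^T = Pxx, posdef Pxx &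
      forall (x : 'cV[R]_nx) (lam : 'cV[R]_nc),
        GrSOL D F (col_mx x lam) -> col_mx x lam != 0 ->
        psi A C Pxx x lam < 0]) ->
    exponentially_stable A C D F 0).
Proof.
split=> -[P [_ /posdef_coercive[a a0 Pa] psiP]]; have [b b0 Pb] := quadform_ub P;
  have c0 : 0 < Num.sqrt (b / a) by rewrite sqrtr_gt0 divr_gt0.
(* With [q = 1] the decay bound reads [|x_k| <= sqrt (b / a) |x_0|], which dictates this radius. *)
- move=> e e0; exists (e / Num.sqrt (b / a)); first by rewrite divr_gt0.
  move=> xhat + x [x0 xS] k; rewrite !subr0 ltr_pdivlMr // mulrC => xe.
  apply: le_lt_trans xe; rewrite -x0.
  have := @lyapunov_decay _ _ _ _ _ _ x a0 Pa Pb b0 ler01 _ k.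
  rewrite sqrtr1 expr1n mulr1; apply=> j; have [lam lamS ->] := xS j.
  by rewrite mul1r -subr_le0 -psiE psiP // /GrSOL /= col_mxKu col_mxKd.
- have [|r r0 Pr] := @quadform_coercive _ _ (GrSOL D F) (- Mlyap A C P)
      (@GrSOL_closed _ _ _ _ _) (@GrSOL_cone _ _ _ _ _).
    move=> z; rewrite -[z]vsubmxK quadformN oppr_gt0; exact: psiP.
  have br : 0 < b + r by rewrite addr_gt0.
  (* The decrease suggests the ratio [1 - r / b]; the larger [b / (b + r)] lies in [[0, 1)] without
     comparing [r] with [b]. *)
  have q0 : 0 <= b / (b + r) by rewrite divr_ge0 ?ltW.
  (* The radius 1 is arbitrary: the estimate is global. *)
  exists 1, (Num.sqrt (b / a)), (Num.sqrt (b / (b + r))); split=> //.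
    by rewrite sqrtr_ge0 -sqrtr1 ltr_sqrt // ltr_pdivrMr // mul1r ltrDl.
  move=> xhat _ x [x0 xS] k; rewrite !subr0 -x0.
  apply: (lyapunov_decay a0 Pa Pb b0 q0) => j; have [lam lamS ->] := xS j.
  have /Pr : GrSOL D F (col_mx (x j) lam) by rewrite /GrSOL /= col_mxKu col_mxKd.
  rewrite quadformN sqr_enorm_col_mx mulrDr => h.
  set W := quadform P _; set V := quadform P (x j); set X := enorm (x j) ^+ 2 in h *.
  (* The term [r |lam|^2] is nonnegative and is dropped. *)
  have WV : W <= V - r * X.
    have := psiE A C P (x j) lam; rewrite /psi -/W -/V => hpsi.
    have : 0 <= r * enorm lam ^+ 2 by rewrite mulr_ge0 ?sqr_ge0 // ltW.
    by rewrite hpsi in h; lra.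
  have VX : V <= b * X by exact: Pb.
  have X0 : 0 <= X by exact: sqr_ge0.
  (* Here [(b + r) W <= (b + r) (V - r X) = b V + r (V - b X) - r^2 X <= b V]. *)
  rewrite mulrAC ler_pdivlMr //.
  have := ler_wpM2r (ltW br) WV; have := ler_wpM2l (ltW r0) VX.
  have := mulr_ge0 (sqr_ge0 r) X0; lra.
Qed.
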